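(* Let $(p,q)\in\mathcal{S} = \{(p',q') \in [0,1]^{2} : 0 < p'+q' \leqslant 1\}$. The PCA $F_{p,q}$ is ergodic if and only if the corresponding envelope PCA $\widehat{F}_{p,q}$ is ergodic.
   Context: A (one-dimensional) probabilistic cellular automaton (PCA) $F$ with finite alphabet $\mathcal{A}$, neighbourhood $\mathcal{N}=\{y_1,\dots,y_m\}\subset\mathbb{Z}$ and stochastic matrix $\varphi:\mathcal{A}^{m}\times\mathcal{A}\to[0,1]$ acts on configurations $\eta\in\mathcal{A}^{\mathbb{Z}}$ as follows: given $\eta$, the random configuration $F\eta\in\mathcal{A}^{\mathbb{Z}}$ has independent coordinates, with $\mathbf{P}[F\eta(x)=b]=\varphi(\eta(x+y_1),\dots,\eta(x+y_m),b)$ for $x\in\mathbb{Z}$, $b\in\mathcal{A}$. If $\eta$ is random with law $\mu$ (a probability measure on $\mathcal{A}^{\mathbb{Z}}$ with the $\sigma$-field generated by cylinder sets), $F\mu$ denotes the law of $F\eta$, and $F^{t}\mu=F(F^{t-1}\mu)$. A measure $\mu$ is stationary for $F$ if $F\mu=\mu$. The PCA $F$ is ergodic if it has a unique stationary measure $\mu$ and, for every probability measure $\nu$ on $\mathcal{A}^{\mathbb{Z}}$, $F^{t}\nu$ converges weakly to $\mu$ as $t\to\infty$. The PCA $F_{p,q}$ has alphabet $\mathcal{A}=\{0,1\}$, neighbourhood $\mathcal{N}=\{0,1,2\}$ and stochastic matrix $\varphi_{p,q}$ given by $\varphi_{p,q}(0,0,0,0)=p$, $\varphi_{p,q}(0,0,0,1)=1-p$,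 and $\varphi_{p,q}(a_0,a_1,a_2,0)=1-q$, $\varphi_{p,q}(a_0,a_1,a_2,1)=q$ for all $(a_0,a_1,a_2)\in\{0,1\}^3\setminus\{(0,0,0)\}$. The envelope PCA $\widehat{F}_{p,q}$ has alphabet $\hat{\mathcal{A}}=\{0,?,1\}$ (three symbols), neighbourhood $\{0,1,2\}$ and stochastic matrix $\widehat{\varphi}_{p,q}$ such that: - $\widehat{\varphi}_{p,q}(0,0,0,\cdot)$ gives mass $p$ to $0$ and $1-p$ to $1$; - for $(a_0,a_1,a_2)\in\hat{\mathcal{A}}^3\setminus\{0,?\}^3$, $\widehat{\varphi}_{p,q}(a_0,a_1,a_2,\cdot)$ gives mass $1-q$ to $0$ and $q$ to $1$; - for $(a_0,a_1,a_2)\in\{0,?\}^3\setminus\{(0,0,0)\}$, $\widehat{\varphi}_{p,q}(a_0,a_1,a_2,\cdot)$ gives mass $p$ to $0$, $q$ to $1$ and $r=1-p-q$ to $?$. *)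

(* Defs.v *)
From HB Require Import structures.
From mathcomp Require Import all_boot all_order all_algebra.
From mathcomp Require Import all_classical all_reals all_analysis.
From mathcomp Require Import measurable_realfun.

Set Implicit Arguments.
Unset Strict Implicit.
Unset Printing Implicit Defensive.

Import Order.TTheory GRing.Theory Num.Theory.
Import numFieldNormedType.Exports.

Local Open Scope classical_set_scope.
Local Open Scope ring_scope.

#[short(type="alphabetType")]
HB.structure Definition Alphabet := {A of Finite A & Pointed A}.

HB.instance Definition _ := Pointed.on bool.
HB.instance Definition _ (A : alphabetType) := Pointed.on (option A).

Definition conf (A : alphabetType) : Type := int -> A.

(* S is a finite set of sites (given as a list); general events B x, rather
   than single letters, make the cylinders stable under intersection. *)
Definition cylinder (A : alphabetType) (S : seq int) (B : int -> {set A}) :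
    set (int -> A) :=
  [set xi | forall x, x \in S -> xi x \in B x].

Definition cylinders (A : alphabetType) : set (set (int -> A)) :=
  [set C | exists S B, C = cylinder S B].

HB.instance Definition _ (A : alphabetType) :=
  Pointed.copy (conf A) (int -> A).
HB.instance Definition _ (A : alphabetType) :=
  Measurable.copy (conf A) (g_sigma_algebraType (@cylinders A)).
HB.instance Definition _ (A : alphabetType) :=
  Topological.copy (conf A) {ptws int -> discrete_topology A}.

(* Infinite product of the probability vectors w x (x in Z), obtained by
   extending a content on the algebra of sets that depend on finitely many
   coordinates; compactness of A^Z gives countable subadditivity. *)
Section product_law.
Context {R : realType} {A : alphabetType}.

Definition determined (n : nat) (C : set (int -> A)) : Prop :=
  forall xi zeta : int -> A,
    (forall x, (pickle x < n)%N -> xi x = zeta x) -> C xi -> C zeta.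

Definition finitary : set (set (int -> A)) :=
  [set C | exists n, determined n C].

(* Copy of the configuration space carrying only the algebra of finitary sets. *)
Definition fconf : Type := int -> A.

Lemma determinedC n C : determined n C -> determined n (~` C).
Proof.
by move=> dC xi zeta h nC Cz; apply: nC; apply: dC Cz => x /h ->.
Qed.

Lemma determinedW m n C : (m <= n)%N -> determined m C -> determined n C.
Proof.
by move=> mn dC xi zeta h; apply: dC => x xm; apply: h; exact: leq_trans mn.
Qed.

Lemma determinedU n C D :
  determined n C -> determined n D -> determined n (C `|` D).
Proof. by move=> dC dD xi zeta h [/(dC _ _ h)|/(dD _ _ h)]; [left|right]. Qed.

Lemma finitary0 : finitary set0. Proof. by exists 0%N. Qed.

Lemma finitaryC : setC_closed finitary.
Proof. by move=> C [n dC]; exists n; exact: determinedC. Qed.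

Lemma finitaryU : setU_closed finitary.
Proof.
move=> C D [m dC] [n dD]; exists (maxn m n).
apply: determinedU; [apply: determinedW dC|apply: determinedW dD].
  exact: leq_maxl.
exact: leq_maxr.
Qed.

HB.instance Definition _ := Pointed.copy fconf (int -> A).
HB.instance Definition _ := @isAlgebraOfSets.Build default_measure_display
  fconf finitary finitary0 finitaryU finitaryC.

Variables (w : int -> A -> R).
Hypothesis w_ge0 : forall x a, 0 <= w x a.
Hypothesis w_sum1 : forall x, \sum_a w x a = 1.

Definition upd (x : int) (a : A) (xi : int -> A) : int -> A :=
  fun y => if y == x then a else xi y.

(* Mass of C when the first n sites (in the enumeration of int by pickle) are
   drawn independently from w and every other site is frozen at point. *)
Fixpoint weight (n : nat) (C : set (int -> A)) : R :=
  if n is m.+1 then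
    if (pickle_inv m : option int) is Some x then
      \sum_a w x a * weight m (upd x a @^-1` C)
    else weight m C
  else (`[< C point >])%:R.

Lemma weight_ge0 n C : 0 <= weight n C.
Proof.
elim: n C => [|n ih] C /=; first by rewrite ler0n.
case: pickle_inv => [x|//]; apply: sumr_ge0 => a _; exact: mulr_ge0.
Qed.

Lemma weight0 n : weight n set0 = 0.
Proof.
elim: n => [|n ih] /=; first by rewrite asboolF.
case: pickle_inv => [x|//]; rewrite big1// => a _.
by rewrite preimage_set0 ih mulr0.
Qed.

Lemma weightT n : weight n setT = 1.
Proof.
elim: n => [|n ih] /=; first by rewrite asboolT.
case: pickle_inv => [x|//]; rewrite -(w_sum1 x); apply: eq_bigr => a _.
by rewrite preimage_setT ih mulr1.
Qed.

Lemma weightU n C D : C `&` D = set0 ->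
  weight n (C `|` D) = weight n C + weight n D.
Proof.
elim: n C D => [|n ih] C D CD /=.
  have : ~ (C point /\ D point) by move=> h; have : (C `&` D) point by []; rewrite CD.
  have [c|c] := asboolP (C point); have [d|d] := asboolP (D point) => h.
  - by case: h.
  - by rewrite asboolT ?addr0//; left.
  - by rewrite asboolT ?add0r//; right.
  - by rewrite asboolF ?addr0// => -[].
case: pickle_inv => [x|]; last exact: ih.
rewrite -big_split; apply: eq_bigr => a _ /=.
by rewrite preimage_setU ih ?mulrDr// -preimage_setI CD preimage_set0.
Qed.

Lemma weight_determined m n C : determined m C -> (m <= n)%N ->
  weight n C = weight m C.
Proof.
move=> dC; elim: n => [|n ih].
  by rewrite leqn0 => /eqP ->.
rewrite leq_eqVlt => /orP[/eqP ->//|mn] /=.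
have := @pickle_invK int n; case: pickle_inv => [x /= xn|_]; last exact: ih.
rewrite -[RHS]mul1r -(w_sum1 x) mulr_suml; apply: eq_bigr => a _.
rewrite -ih//; congr (_ * weight n _).
have h xi y : (pickle y < m)%N -> upd x a xi y = xi y.
  by rewrite /upd; case: eqP => // ->; rewrite xn ltnNge -ltnS mn.
apply/seteqP; split => xi /=; apply: dC => y ym; by rewrite h.
Qed.

Definition premeasure (C : set fconf) : \bar R :=
  (weight (xget 0%N [set n | determined n C]) C)%:E.

Lemma premeasureE n C : determined n C -> premeasure C = (weight n C)%:E.
Proof.
move=> dC; rewrite /premeasure; case: xgetP => [m _ dm|/(_ n)]; last by case.
congr EFin; rewrite -(weight_determined dC (leq_maxl n m)).
by rewrite -(weight_determined dm (leq_maxr n m)).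
Qed.

Lemma premeasure_ge0 C : (0 <= premeasure C)%E.
Proof. by rewrite lee_fin weight_ge0. Qed.

Lemma premeasure_additive : measure_function.semi_additive premeasure.
Proof.
apply/additive2P; first by rewrite /premeasure weight0.
move=> C D [m dC] [n dD] CD.
have dC' := determinedW (leq_maxl m n) dC.
have dD' := determinedW (leq_maxr m n) dD.
rewrite (premeasureE dC') (premeasureE dD') (premeasureE (determinedU dC' dD')).
by rewrite weightU.
Qed.

HB.instance Definition _ := isContent.Build default_measure_display fconf R
  premeasure premeasure_ge0 premeasure_additive.

Lemma conf_compact : compact [set: conf A].
Proof.
have := @tychonoff int (fun=> discrete_topology A) (fun=> setT)
  (fun=> @finite_compact (discrete_topology A) setT (@finite_finset A setT)).
by congr (compact _); rewrite eqEsubset.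
Qed.

Lemma determined_open n (C : set (conf A)) : determined n C -> open C.
Proof.
move=> dC; rewrite openE => xi Cxi; rewrite /interior.
have : nbhs xi [set zeta : conf A |
    forall x, (pickle x < n)%N -> xi x = zeta x].
  elim: n {dC} => [|n ih]; first by apply: filterS (@filterT _ (nbhs xi) _) => //.
  have [[x xn]|nx] := pselect (exists x : int, pickle x = n); last first.
    apply: filterS ih => zeta h x; rewrite ltnS leq_eqVlt => /orP[/eqP xn|/h//].
    by case: nx; exists x.
  have hx : nbhs xi [set zeta : conf A | xi x = zeta x].
    have pc := @proj_continuous int (fun=> discrete_topology A) x xi.
    have P : nbhs xi [set zeta : conf A | zeta x = xi x].
      exact: (pc [set xi x] (@discrete_set1 (discrete_topology A) (xi x))).
    by apply: filterS P => zeta /= ->.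
  apply: filterS (filterI ih hx) => zeta [h1 h2] y.
  rewrite ltnS leq_eqVlt => /orP[/eqP|/h1//]; rewrite -xn => /(pcan_inj pickleK) ->.
  exact: h2.
apply: filterS => zeta h; exact: dC Cxi.
Qed.

Lemma premeasure_sigma_subadditive :
  measurable_subset_sigma_subadditive premeasure.
Proof.
move=> C F mF [n dC] CF.
have : compact (C : set (conf A)).
  apply: (subclosed_compact _ conf_compact) => //.
  rewrite -[C]setCK closedC; apply: (@determined_open n); exact: determinedC.
rewrite compact_cover => /(_ nat setT F).
case=> [i _|//|D _ CD]; first by have [k dk] := mF i; exact: determined_open dk.
pose N := (\max_(i <- finmap.enum_fset D) i).+1.
have CN : C `<=` \big[setU/set0]_(i < N) F i.
  move=> xi /CD[i /= iD Fi]; rewrite -bigcup_mkord; exists i => //=.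
  by rewrite ltnS; exact: (@leq_bigmax_seq nat (finmap.enum_fset D) xpredT (fun k => k)).
apply: (@le_trans _ _ (\sum_(i < N) premeasure (F i))%E).
  apply: (@content_subadditive _ _ _ premeasure) => //; by exists n.
rewrite -(big_mkord xpredT (premeasure \o F)).
exact: nneseries_lim_ge.
Qed.

HB.instance Definition _ := Content_SigmaSubAdditive_isMeasure.Build
  default_measure_display R fconf premeasure premeasure_sigma_subadditive.

Lemma cylinder_determined (S : seq int) (B : int -> {set A}) :
  determined (\max_(x <- S) pickle x).+1 (cylinder S B).
Proof.
move=> xi zeta h hxi x xS; rewrite -h ?hxi//.
by rewrite ltnS; exact: (@leq_bigmax_seq int S xpredT pickle).
Qed.

Lemma weight_cylinder n (S : seq int) (B : int -> {set A}) : uniq S ->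
  (forall x, x \in S -> (pickle x < n)%N) ->
  weight n (cylinder S B) = \prod_(x <- S) \sum_(a in B x) w x a.
Proof.
elim: n S => [|n ih] S uS Sn /=.
  have -> : S = [::] by case: S uS Sn => // x S _ /(_ x (mem_head _ _)).
  by rewrite big_nil asboolT.
have step (T : seq int) : {subset T <= S} -> uniq T -> (forall x, x \in T -> pickle x != n) ->
    weight n (cylinder T B) = \prod_(x <- T) \sum_(a in B x) w x a.
  move=> TS uT Tn; apply: ih => // x xT; have := Sn _ (TS _ xT).
  by rewrite ltnS leq_eqVlt (negbTE (Tn _ xT)).
have := @pickle_invK int n; case E: pickle_inv => [x|] /= xn; last first.
  apply: step => // x xS; apply/negP => /eqP xn'.
  by move: E; rewrite -xn' pickleK_inv.
have inj y : pickle y = n -> y = x.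
  by rewrite -xn => /(pcan_inj pickleK).
have [xS|xS] := boolP (x \in S); last first.
  transitivity ((\sum_a w x a) * \prod_(y <- S) \sum_(a in B y) w y a); last first.
    by rewrite w_sum1 mul1r.
  rewrite mulr_suml; apply: eq_bigr => a _.
  congr (_ * _); rewrite -step//; last first.
    by move=> y yS; apply/eqP => /inj yx; move: xS; rewrite -yx yS.
  congr (weight n _); apply/seteqP; split => xi h y yS; have := h y yS;
    rewrite /upd; by case: eqP => // yx; move: xS; rewrite -yx yS.
have uT : uniq (rem x S) by rewrite rem_uniq.
rewrite (perm_big _ (perm_to_rem xS)) big_cons /= mulr_suml [RHS]big_mkcond.
apply: eq_bigr => a _ /=; case: ifPn => aB.
  rewrite -step//; first last.
  - move=> y; rewrite mem_rem_uniq// inE => /andP[yx _].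
    by apply: contra yx => /eqP /inj ->.
  - by move=> y /mem_rem.
  congr (_ * weight n _); apply/seteqP; split => xi h y yS.
    have := h y (mem_rem yS); rewrite /upd; case: eqP => // yx.
    by move: yS; rewrite yx mem_rem_uniq// inE eqxx.
  rewrite /upd; case: eqP => [->//|/eqP yx]; apply: h.
  by rewrite mem_rem_uniq// inE yx.
rewrite [X in weight n X](_ : _ = set0) ?weight0 ?mulr0//.
apply/seteqP; split => // xi /(_ x xS); rewrite /upd eqxx; exact/negP.
Qed.

Lemma sub_sigma_finitary :
  <<s @cylinders A >> `<=` <<s @measurable _ fconf >>.
Proof.
apply: sub_sigma_algebra2 => _ [S [B ->]].
eexists; exact: cylinder_determined.
Qed.

Definition product_measure : set (conf A) -> \bar R :=
  measure_extension premeasure.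

Lemma product_measure0 : product_measure set0 = 0%E.
Proof. exact: (@measure0 _ _ _ (measure_extension premeasure)). Qed.

Lemma product_measure_ge0 (C : set (conf A)) : (0 <= product_measure C)%E.
Proof. exact: (@measure_ge0 _ _ _ (measure_extension premeasure)). Qed.

Lemma product_measure_sigma_additive : semi_sigma_additive product_measure.
Proof.
move=> F mF tF mUF.
apply: (@measure_semi_sigma_additive _ _ _ (measure_extension premeasure)) => //.
  by move=> i; apply: sub_sigma_finitary; exact: mF.
exact: sub_sigma_finitary.
Qed.

HB.instance Definition _ := isMeasure.Build _ (conf A) R product_measure
  product_measure0 product_measure_ge0 product_measure_sigma_additive.

Lemma product_measure_cylinder (S : seq int) (B : int -> {set A}) : uniq S ->
  product_measure (cylinder S B) = (\prod_(x <- S) \sum_(a in B x) w x a)%:E.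
Proof.
move=> uS; have dC := @cylinder_determined S B.
rewrite /product_measure /measure_extension measurable_mu_extE; last first.
  by eexists; exact: dC.
rewrite [LHS](premeasureE dC) weight_cylinder// => x xS.
by rewrite ltnS; exact: (@leq_bigmax_seq int S xpredT pickle).
Qed.

Lemma product_measureT : product_measure setT = 1%E.
Proof.
have <- : @cylinder A [::] (fun=> finset.set0) = setT.
  by apply/seteqP; split.
by rewrite product_measure_cylinder// big_nil.
Qed.

HB.instance Definition _ := Measure_isProbability.Build _ _ _
  product_measure product_measureT.

(* Under P the coordinates are independent, the one at x having law w x. *)
Lemma product_law_exists : exists P : probability (conf A) R,
  forall (S : seq int) (B : int -> {set A}), uniq S ->
    P (cylinder S B) = (\prod_(x <- S) \sum_(a in B x) w x a)%:E.
Proof. by exists product_measure => S B; exact: product_measure_cylinder. Qed.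

End product_law.

Lemma cylindersI (A : alphabetType) : setI_closed (@cylinders A).
Proof.
move=> _ _ [S [B ->]] [T [D ->]]; exists (S ++ T).
exists (fun x => [set a | ((x \in S) ==> (a \in B x))
                        && ((x \in T) ==> (a \in D x))]%SET).
apply/seteqP; split => xi.
  move=> [h1 h2] x _; rewrite inE; apply/andP; split; apply/implyP.
    exact: h1.
  exact: h2.
move=> h; split => x xS; have := h x; rewrite mem_cat xS ?orbT => /(_ isT);
  by rewrite inE => /andP[/= h1 h2].
Qed.

Lemma cylinder_undup (A : alphabetType) S (B : int -> {set A}) :
  cylinder (undup S) B = cylinder S B.
Proof. by apply/seteqP; split => xi h x xS; apply: h; move: xS; rewrite mem_undup. Qed.

(* The neighbourhood {y_1, ..., y_m} is listed without repetition, and the rows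
   of the matrix are indexed by the tuples of states read in that order. *)
Record pca (R : realType) (A : alphabetType) := PCA {
  pca_size : nat;
  pca_nbhd : pca_size.-tuple int;
  pca_nbhd_uniq : uniq pca_nbhd;
  pca_matrix : pca_size.-tuple A -> A -> R;
  pca_matrix_ge0 : forall v b, 0 <= pca_matrix v b;
  pca_matrix_sum1 : forall v, \sum_b pca_matrix v b = 1 }.

Arguments pca_matrix {R A} _ _ _.

Section dynamics.
Context {R : realType} {A : alphabetType}.
Variable F : pca R A.

(* phi (eta (x + y_1), ..., eta (x + y_m), b) *)
Definition site_law (eta : conf A) (x : int) (b : A) : R :=
  pca_matrix F (map_tuple (fun y => eta (x + y)) (pca_nbhd F)) b.

Lemma site_law_ge0 eta x b : 0 <= site_law eta x b.
Proof. exact: pca_matrix_ge0. Qed.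

Lemma site_law_sum1 eta x : \sum_b site_law eta x b = 1.
Proof. exact: pca_matrix_sum1. Qed.

(* The law of the random configuration F eta for a fixed eta. It is the unique
   probability with the product values on cylinders, as these form a
   pi-system generating the sigma-algebra. *)
Definition update_law (eta : conf A) : probability (conf A) R :=
  projT1 (cid (product_law_exists (site_law_ge0 eta) (site_law_sum1 eta))).

Lemma update_lawE eta S B : uniq S ->
  update_law eta (cylinder S B) =
  (\prod_(x <- S) \sum_(b in B x) site_law eta x b)%:E.
Proof. by rewrite /update_law; case: cid => P /= h; exact: h. Qed.

Lemma measurable_site_law x b :
  measurable_fun [set: conf A] (fun eta => site_law eta x b).
Proof.
pose nb (eta : conf A) := map_tuple (fun y => eta (x + y)) (pca_nbhd F).
have -> : (fun eta => site_law eta x b) = (fun eta =>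
    \sum_(v : (pca_size F).-tuple A) pca_matrix F v b * \1_[set e | nb e = v] eta).
  apply/funext => eta; rewrite (bigD1 (nb eta))//= big1 ?addr0 => [|v vn].
    by rewrite indicE mem_set// mulr1.
  by rewrite indicE memNset ?mulr0//= => /eqP; rewrite eq_sym (negbTE vn).
apply: measurable_sum => v; apply: measurable_funM => //.
apply: measurable_indic.
have -> : [set e | nb e = v] = \bigcap_(i in [set: 'I_(pca_size F)])
    cylinder [:: x + tnth (pca_nbhd F) i] (fun=> [set tnth v i]%SET).
  apply/seteqP; split => e /=.
    by move=> <- i _ z; rewrite !inE => /eqP ->; rewrite tnth_map.
  move=> h; apply: eq_from_tnth => i; rewrite tnth_map.
  by have := h i I (x + tnth (pca_nbhd F) i) (mem_head _ _); rewrite inE => /eqP.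
apply: fin_bigcap_measurable => // i _; apply: sub_sigma_algebra.
by eexists; eexists.
Qed.

Lemma measurable_update_law C : measurable C ->
  measurable_fun [set: conf A] (fun eta => update_law eta C).
Proof.
move=> mC; move: (mC); have : <<s @cylinders A >> C by [].
move: C {mC}; apply: (@dynkin_induction _ (conf A) (@cylinders A)
  (fun C => measurable C -> measurable_fun [set: conf A]
     (fun eta => update_law eta C))) => //.
- exact: cylindersI.
- move=> _; have -> : (fun eta => update_law eta setT) = cst 1%E.
    by apply/funext => eta; rewrite probability_setT.
  exact: measurable_cst.
- move=> _ [S [B ->]] _; rewrite -cylinder_undup.
  have -> : (fun eta => update_law eta (cylinder (undup S) B)) = (fun eta =>
      (\prod_(x <- undup S) \sum_(b in B x) site_law eta x b)%:E).
    by apply/funext => eta; rewrite update_lawE ?undup_uniq.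
  apply/measurable_EFinP; apply: measurable_prod => x _.
  have -> : (fun eta => \sum_(b in B x) site_law eta x b) =
      (fun eta => \sum_(b <- enum (B x)) site_law eta x b).
    by apply/funext => eta; rewrite big_enum.
  by apply: measurable_sum => b; exact: measurable_site_law.
- move=> C mC ih _; have -> : (fun eta => update_law eta (~` C)) =
      (fun eta => 1 - update_law eta C)%E.
    by apply/funext => eta; rewrite probability_setC.
  by apply: emeasurable_funB => //; exact: ih.
- move=> G mG tG ih _.
  have -> : (fun eta => update_law eta (\bigcup_k G k)) =
      (fun eta => \sum_(0 <= k <oo) update_law eta (G k))%E.
    by apply/funext => eta; rewrite measure_semi_bigcup//; exact: bigcup_measurable.
  apply: ge0_emeasurable_sum => // k _; exact: ih.
Qed.

Variable mu : probability (conf A) R.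

(* The law F mu of F eta when eta has law mu. *)
Definition step_fun (C : set (conf A)) : \bar R :=
  (\int[mu]_eta update_law eta C)%E.

Lemma step_fun0 : step_fun set0 = 0%E.
Proof. by rewrite /step_fun integral0_eq. Qed.

Lemma step_fun_ge0 C : (0 <= step_fun C)%E.
Proof. exact: integral_ge0. Qed.

Lemma step_fun_sigma_additive : semi_sigma_additive step_fun.
Proof.
move=> G mG tG mUG; rewrite /step_fun.
have -> : (\int[mu]_eta update_law eta (\bigcup_k G k) =
    \int[mu]_eta \sum_(0 <= k <oo) update_law eta (G k))%E.
  by apply: eq_integral => eta _; rewrite measure_semi_bigcup.
rewrite integral_nneseries//; last by move=> k; exact: measurable_update_law.
by apply: is_cvg_nneseries => n _ _; exact: integral_ge0.
Qed.

HB.instance Definition _ := isMeasure.Build _ _ _ step_fun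
  step_fun0 step_fun_ge0 step_fun_sigma_additive.

Lemma step_funT : step_fun setT = 1%E.
Proof.
rewrite /step_fun; under eq_integral do rewrite probability_setT.
rewrite integral_cst// mul1e; exact: probability_setT.
Qed.

HB.instance Definition _ := Measure_isProbability.Build _ _ _ step_fun step_funT.

Definition step : probability (conf A) R := step_fun.

End dynamics.

Section ergodicity.
Context {R : realType} {A : alphabetType}.

Definition weak_cvg (nu : nat -> probability (conf A) R)
    (mu : probability (conf A) R) : Prop :=
  forall f : conf A -> R, continuous f -> bounded_fun f ->
    (\int[nu t]_xi (f xi)%:E @[t --> \oo] --> \int[mu]_xi (f xi)%:E)%E.

Variable F : pca R A.

(* Measures here are functions on all sets, with unspecified values outside the
   sigma-algebra, so equality of laws is equality on measurable sets. *)
Definition stationary (mu : probability (conf A) R) : Prop :=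
  forall C : set (conf A), measurable C -> step F mu C = mu C.

Definition ergodic : Prop :=
  exists mu : probability (conf A) R,
  [/\ stationary mu,
      (forall nu, stationary nu ->
        forall C : set (conf A), measurable C -> nu C = mu C) &
      forall nu, weak_cvg (fun t => iter t (step F) nu) mu].

End ergodicity.

Definition region_S (R : realType) (p q : R) : Prop :=
  [/\ 0 <= p <= 1, 0 <= q <= 1 & 0 < p + q <= 1].

Definition nbhd012 : 3.-tuple int := [tuple 0; 1; 2].

Section binary_and_envelope.
Context {R : realType}.
Variables (p q : R).

(* The letters 0 and 1 are false and true. *)
Definition phi (v : 3.-tuple bool) (b : bool) : R :=
  if v == [tuple false; false; false] then (if b then 1 - p else p)
  else (if b then q else 1 - q).

(* The letters 0, ? and 1 are Some false, None and Some true. *)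
Definition phi_env (v : 3.-tuple (option bool)) (b : option bool) : R :=
  if v == [tuple Some false; Some false; Some false] then
    match b with Some false => p | Some true => 1 - p | None => 0 end
  else if all (mem [:: Some false; None]) v then
    match b with Some false => p | Some true => q | None => 1 - p - q end
  else
    match b with Some false => 1 - q | Some true => q | None => 0 end.

Hypothesis pqS : region_S p q.

Lemma phi_ge0 v b : 0 <= phi v b.
Proof.
by case: pqS => /andP[? ?] /andP[? ?] _; rewrite /phi; case: ifP; case: b;
  rewrite ?subr_ge0.
Qed.

Lemma phi_sum1 v : \sum_b phi v b = 1.
Proof.
by rewrite big_bool /phi; case: ifP => _ /=; rewrite ?subrK// addrC subrK.
Qed.

Lemma phi_env_ge0 v b : 0 <= phi_env v b.
Proof.
case: pqS => /andP[? ?] /andP[? ?] /andP[_ ?]; rewrite /phi_env.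
have r0 : 0 <= 1 - p - q by rewrite -addrA -opprD subr_ge0.
by case: ifP => _; [|case: ifP => _]; case: b => [[]|] //; rewrite subr_ge0.
Qed.

Lemma phi_env_sum1 v : \sum_b phi_env v b = 1.
Proof.
rewrite (bigD1 None)//= (bigD1 (Some false))//= (bigD1 (Some true))//=.
rewrite big1 => [|[[]|]//]; rewrite addr0 /phi_env.
case: ifP => _; first by rewrite add0r addrC subrK.
case: ifP => _; last by rewrite add0r subrK.
by rewrite -[1 - p - q]addrA -opprD subrK.
Qed.

Definition pca_pq : pca R bool :=
  @PCA R bool 3 nbhd012 isT phi phi_ge0 phi_sum1.
Definition envelope_pq : pca R (option bool) :=
  @PCA R (option bool) 3 nbhd012 isT phi_env phi_env_ge0 phi_env_sum1.

End binary_and_envelope.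

(* Main.v *)
(* The envelope carries two copies of F: reading the letters 0, ?, 1 as the
   pairs (0,0), (0,1), (1,1), the lower component of the updated configuration
   is distributed as F applied to the upper component of the old one, and vice
   versa; on configurations without ? the envelope is F itself.  If F is
   ergodic, then under the envelope the laws of both components converge to mu
   from any start, so the density of ? at a site, which is the difference of the
   densities of 1 in the two components, tends to 0 and the envelope converges
   to mu.  Conversely, starting the envelope without ?, both components evolve
   as F, so their limits coincide, and this common limit is stationary. *)
Require Import Defs.
From HB Require Import structures.
From mathcomp Require Import all_boot all_order all_algebra.
From mathcomp Require Import all_classical all_reals all_analysis.
From mathcomp Require Import measurable_realfun.
From mathcomp Require Import ring lra.

Set Implicit Arguments.
Unset Strict Implicit.
Unset Printing Implicit Defensive.

Import Order.TTheory GRing.Theory Num.Theory.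
Import numFieldNormedType.Exports.

Local Open Scope classical_set_scope.
Local Open Scope ring_scope.

(** * Topology and sigma-algebra of the configuration space *)

Section configuration_space.
Context {A : alphabetType}.

Definition agree (n : nat) (xi zeta : conf A) : Prop :=
  forall x : int, (pickle x < n)%N -> xi x = zeta x.

Lemma agree_trans n xi zeta theta :
  agree n xi zeta -> agree n zeta theta -> agree n xi theta.
Proof. by move=> h k x xn; rewrite h// k. Qed.

Lemma agreeW m n xi zeta : (m <= n)%N -> agree n xi zeta -> agree m xi zeta.
Proof. by move=> mn h x xm; apply: h; exact: leq_trans mn. Qed.

Lemma determined_agree n xi : determined n (agree n xi).
Proof. by move=> zeta theta h k; exact: agree_trans h. Qed.

(** Compactness gives a finite subcover, and by monotonicity its member of largest index already
    contains all the others. *)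
Lemma compact_nondecreasing_cover (U : nat -> set (conf A)) :
  (forall n, open (U n)) -> (forall n, U n `<=` U n.+1) ->
  (forall xi, exists n, U n xi) -> exists n, forall xi, U n xi.
Proof.
move=> oU incU cov.
have := @conf_compact A; rewrite compact_cover => /(_ nat setT U).
case=> [i _|xi _|D _ CD]; [exact: oU|by have [n Un] := cov xi; exists n|].
exists (\max_(i <- finmap.enum_fset D) i)%N => xi.
have [i /= iD Ui] := CD xi I.
have : (i <= \max_(i <- finmap.enum_fset D) i)%N.
  exact: (@leq_bigmax_seq nat (finmap.enum_fset D) xpredT (fun k => k)).
elim: (\max_(i <- _) i)%N => [|n ih]; first by rewrite leqn0 => /eqP <-.
by rewrite leq_eqVlt => /orP[/eqP <-//|/ih]; exact: incU.
Qed.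

(** Every configuration other than [xi] differs from it at some site, so [U] together with the
    complements of the sets [agree n xi] covers the space. By compactness a single [n] suffices. *)
Lemma open_agree (U : set (conf A)) xi : open U -> U xi ->
  exists n, agree n xi `<=` U.
Proof.
move=> oU Uxi.
have [] := @compact_nondecreasing_cover (fun n => U `|` ~` agree n xi).
- move=> n; apply: openU => //; apply: (@determined_open _ n).
  exact/determinedC/determined_agree.
- move=> n zeta [Uz|h]; [by left|right => k; exact/h/(agreeW _ k)].
- move=> zeta; have [<-|] := pselect (xi = zeta); first by exists 0%N; left.
  move=> ne; have [x xz] : exists x, xi x <> zeta x.
    by apply/existsNP => h; apply: ne; exact/funext.
  exists (pickle x).+1; right => /(_ x (ltnSn _)); exact: xz.
by move=> n h; exists n => zeta xz; have [|/(_ xz)] := h zeta.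
Qed.

(** The largest subset of [U] determined by the first [n] sites; it reduces open sets to countable
    unions of finitary ones. *)
Definition interior_at (n : nat) (U : set (conf A)) : set (conf A) :=
  [set xi | agree n xi `<=` U].

Lemma determined_interior_at n U : determined n (interior_at n U).
Proof.
by move=> xi zeta h k theta zt; apply: k; exact: agree_trans zt.
Qed.

Lemma interior_at_sub n U : interior_at n U `<=` U.
Proof. by move=> xi; apply; move=> x. Qed.

Lemma open_bigcup_interior_at (U : set (conf A)) : open U ->
  U = \bigcup_n interior_at n U.
Proof.
move=> oU; apply/seteqP; split=> xi.
  by move=> /(open_agree oU)[n h]; exists n.
by case=> n _; exact: interior_at_sub.
Qed.

(** The sets [V n] of configurations around which [f] oscillates by less than [e] on [agree n] are
    open and increasing, and cover the space by continuity; compactness makes [n] uniform. *)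
Lemma uniformly_continuous (R : realType) (f : conf A -> R) (e : R) :
  continuous f -> 0 < e ->
  exists n, forall xi zeta, agree n xi zeta -> `|f xi - f zeta| < e.
Proof.
move=> cf e0; pose V n := [set xi : conf A | forall zeta theta,
  agree n xi zeta -> agree n xi theta -> `|f zeta - f theta| < e].
have [||xi|n h] := @compact_nondecreasing_cover V.
- move=> n; apply: (@determined_open _ n) => xi zeta h k a b za zb.
  by apply: k; [exact: agree_trans za|exact: agree_trans zb].
- by move=> n xi h a b xa xb; apply: h; [exact: agreeW xa|exact: agreeW xb].
- have e2 : 0 < e / 2 by rewrite divr_gt0.
  have /open_agree := (continuousP _).1 cf _ (@ball_open _ _ (f xi) (e / 2)).
  case/(_ xi) => [|n h]; first exact: ballxx.
  exists n => zeta theta /h /= zx /h /= tx.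
  by rewrite [e]splitr (le_lt_trans (ler_distD (f xi) _ _))// ltrD// distrC.
- by exists n => xi zeta xz; apply: (h xi).
Qed.

(** Induction on [n]: slicing [C] by the letter at the last site leaves finitely many pieces, each a
    one-site cylinder intersected with a set determined by the earlier sites. *)
Lemma determined_measurable n (C : set (conf A)) :
  determined n C -> measurable C.
Proof.
elim: n C => [|n ih] C dC.
  (* A set that depends on no site is empty or everything. *)
  have [[xi Cxi]|nC] := pselect (exists xi, C xi).
    have -> : C = setT by apply/seteqP; split=> // zeta _; exact: dC Cxi.
    exact: measurableT.
  have -> : C = set0.
    by apply/seteqP; split=> // xi Cxi; apply: nC; exists xi.
  exact: measurable0.
(* [n] may fail to be the code of an integer, and then no new site is involved. *)
have [[x xn]|nx] := pselect (exists x : int, pickle x = n); last first.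
  apply: ih => xi zeta h; apply: dC => x; rewrite ltnS leq_eqVlt.
  by move=> /orP[/eqP xn|/h//]; case: nx; exists x.
have -> : C = \bigcup_(a in [set: A])
    (cylinder [:: x] (fun=> [set a]%SET) `&` upd x a @^-1` C).
  have updE (xi : conf A) : upd x (xi x) xi = xi.
    by apply/funext => y; rewrite /upd; case: eqP => [->|].
  apply/seteqP; split=> xi.
    move=> Cxi; exists (xi x) => //; split; last by rewrite /= updE.
    by move=> y; rewrite !inE => /eqP ->.
  case=> a _ [/(_ x (mem_head _ _))]; rewrite inE => /eqP <-.
  by rewrite /= updE.
apply: fin_bigcup_measurable => [|a _]; first exact: finite_finset.
apply: measurableI.
  by apply: sub_sigma_algebra; eexists; eexists.
apply: ih => xi zeta h; apply: dC => y; rewrite ltnS leq_eqVlt /upd.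
case: (y =P x) => // yx /orP[/eqP yn|/h//]; case: yx.
by apply: (pcan_inj (@pickleK int)); rewrite xn.
Qed.

End configuration_space.

Lemma open_measurable_conf (A : alphabetType) (U : set (conf A)) :
  open U -> measurable U.
Proof.
move=> oU; rewrite (open_bigcup_interior_at oU); apply: bigcupT_measurable => n.
exact: determined_measurable (@determined_interior_at _ n U).
Qed.

(** * Continuous test functions and finitary events *)

Section real_functions.
Context {R : realType} {A : alphabetType}.
Implicit Types (f : conf A -> R) (mu : probability (conf A) R).

Lemma continuous_conf_measurable f :
  continuous f -> measurable_fun [set: conf A] f.
Proof.
move=> /continuousP cf; apply: (measurability _ (RGenOInfty.measurableE R)).
move=> _ [_ [a ->] <-]; rewrite setTI; apply: open_measurable_conf.
exact/cf/rray_open.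
Qed.

Lemma continuous_conf_integrable mu f : continuous f -> bounded_fun f ->
  mu.-integrable [set: conf A] (EFin \o f).
Proof.
move=> cf bf; apply: measurable_bounded_integrable => //.
  by apply: (le_lt_trans (probability_le1 mu measurableT)); rewrite ltry.
exact: continuous_conf_measurable.
Qed.

Lemma determined_indic_continuous n (C : set (conf A)) :
  determined n C -> continuous (\1_C : conf A -> R).
Proof.
move=> dC; apply/continuousP => U _; apply: (@determined_open _ n).
have E xi zeta : (forall x : int, (pickle x < n)%N -> xi x = zeta x) ->
    (\1_C xi : R) = \1_C zeta.
  move=> h; rewrite !indicE; congr (_%:R); congr (nat_of_bool _).
  by apply/idP/idP; rewrite !inE; apply: dC => // x /h.
by move=> xi zeta h /=; rewrite (E _ _ h).
Qed.

Lemma indic_bounded (C : set (conf A)) : bounded_fun (\1_C : conf A -> R).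
Proof.
exists 1; split => // x x1 xi _ /=; rewrite indicE.
by apply: le_trans (ltW x1); case: (_ \in _); rewrite ?normr1 ?normr0.
Qed.

(** Sets determined by finitely many sites are clopen, so their indicators are admissible test
    functions. *)
Lemma weak_cvg_determined n (C : set (conf A)) nu mu :
  weak_cvg nu mu -> determined n C -> nu t C @[t --> \oo] --> mu C.
Proof.
move=> h dC; have mC := determined_measurable dC.
have := h _ (determined_indic_continuous dC) (@indic_bounded C).
rewrite integral_indic// setIT; apply: cvg_trans; apply: near_eq_cvg.
by apply: nearW => t; rewrite integral_indic// setIT.
Qed.

End real_functions.

(** * Equality of laws and ergodicity *)

Section laws.
Context {R : realType} {A : alphabetType}.
Implicit Types mu nu : probability (conf A) R.

Definition eqlaw mu nu : Prop := forall C : set (conf A), measurable C -> mu C = nu C.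

Lemma eqlaw_sym mu nu : eqlaw mu nu -> eqlaw nu mu.
Proof. by move=> h C mC; rewrite h. Qed.

Lemma eqlaw_trans mu nu la : eqlaw mu nu -> eqlaw nu la -> eqlaw mu la.
Proof. by move=> h k C mC; rewrite h// k. Qed.

Lemma eqlaw_integral mu nu (f : conf A -> \bar R) : eqlaw mu nu ->
  (\int[mu]_xi f xi = \int[nu]_xi f xi)%E.
Proof. by move=> h; apply: eq_measure_integral => C mC _; exact: h. Qed.

(** Cylinders form a pi-system generating the sigma-algebra; [undup] reduces to lists without
    repetition, for which the product formula is available. *)
Lemma eqlaw_cylinder mu nu :
  (forall S B, uniq S -> mu (cylinder S B) = nu (cylinder S B)) -> eqlaw mu nu.
Proof.
move=> h C; apply: (@measure_unique _ R (conf A) (@cylinders A) (fun=> setT)) => //.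
- exact: cylindersI.
- by move=> _; exists [::], (fun=> finset.set0); apply/seteqP; split.
- by rewrite bigcup_const//; exists 0%N.
- by move=> _ [S [B ->]]; rewrite -cylinder_undup; exact/h/undup_uniq.
- move=> _; apply: (@le_lt_trans _ _ 1%E); last exact: ltry.
  exact: probability_le1.
Qed.

Lemma weak_cvg_unique (nu_ : nat -> probability (conf A) R) mu nu :
  weak_cvg nu_ mu -> weak_cvg nu_ nu -> eqlaw mu nu.
Proof.
move=> hmu hnu; apply: eqlaw_cylinder => S B _.
have dC := @cylinder_determined A S B.
apply: (cvg_unique _ (weak_cvg_determined hmu dC) (weak_cvg_determined hnu dC)).
exact: ereal_hausdorff.
Qed.

Lemma weak_cvg_eqlaw (nu_ nu'_ : nat -> probability (conf A) R) mu :
  (forall t, eqlaw (nu_ t) (nu'_ t)) -> weak_cvg nu_ mu -> weak_cvg nu'_ mu.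
Proof.
move=> e h f cf bf; apply: cvg_trans (h f cf bf); apply: near_eq_cvg.
by apply: nearW => t; exact: eqlaw_integral.
Qed.

Lemma weak_cvg_eqlaw_cst mu nu :
  eqlaw mu nu -> weak_cvg (fun=> mu) nu.
Proof.
by move=> e f _ _; rewrite -(eqlaw_integral _ e); exact: cvg_cst.
Qed.

Variable F : pca R A.

Lemma eqlaw_step mu nu : eqlaw mu nu -> eqlaw (step F mu) (step F nu).
Proof. by move=> h C _; exact: eqlaw_integral. Qed.

Lemma stationary_iter mu t : stationary F mu -> eqlaw (iter t (step F) mu) mu.
Proof.
move=> h; elim: t => [//|t ih] /=.
by apply: eqlaw_trans h; exact: eqlaw_step.
Qed.

(** Uniqueness of the stationary law is automatic: the iterates of a stationary law are constant, so
    that law coincides with their weak limit. *)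
Lemma ergodicP : ergodic F <->
  exists2 mu, stationary F mu & forall nu, weak_cvg (fun t => iter t (step F) nu) mu.
Proof.
split=> [[mu [? _ ?]]|[mu smu h]]; first by exists mu.
exists mu; split=> // nu snu; apply: (@weak_cvg_unique (fun t => iter t (step F) nu)) => //.
apply: (@weak_cvg_eqlaw (fun=> nu)) => [t|]; last exact: weak_cvg_eqlaw_cst.
exact/eqlaw_sym/stationary_iter.
Qed.

End laws.

(** * Images of laws under letter-by-letter maps *)

Definition letterwise (A B : alphabetType) (f : A -> B) : conf A -> conf B :=
  fun xi x => f (xi x).

Section letterwise.
Context {A B : alphabetType}.
Variable f : A -> B.

Lemma preimage_letterwise_cylinder S (D : int -> {set B}) :
  letterwise f @^-1` cylinder S D = cylinder S (fun x => f @^-1: D x)%SET.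
Proof.
by apply/seteqP; split=> xi h x xS; have := h x xS; rewrite inE.
Qed.

Lemma letterwise_measurable : measurable_fun [set: conf A] (letterwise f).
Proof.
apply: (@measurability _ _ (conf A) (conf B) _ _ (@cylinders B)) => //.
move=> _ [_ [S [D ->]] <-]; rewrite setTI preimage_letterwise_cylinder.
by apply: sub_sigma_algebra; eexists; eexists.
Qed.

HB.instance Definition _ :=
  isMeasurableFun.Build _ _ (conf A) (conf B) (letterwise f) letterwise_measurable.

Lemma letterwise_continuous : continuous (letterwise f).
Proof.
apply/continuousP => U oU; rewrite (open_bigcup_interior_at oU) preimage_bigcup.
apply: bigcup_open => n _; apply: (@determined_open _ n) => xi zeta h.
by apply: determined_interior_at => x /h xz; rewrite /letterwise xz.
Qed.

End letterwise.

Definition lawmap (R : realType) (A B : alphabetType) (f : A -> B)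
  (nu : probability (conf A) R) : probability (conf B) R :=
  distribution nu (letterwise f).

Section lawmap.
Context {R : realType} {A B : alphabetType}.
Variable f : A -> B.
Implicit Types nu : probability (conf A) R.

Lemma lawmapE nu C : lawmap f nu C = nu (letterwise f @^-1` C).
Proof. by []. Qed.

Lemma letterwise_measurable_preimage (C : set (conf B)) :
  measurable C -> measurable (letterwise f @^-1` C : set (conf A)).
Proof. by move=> mC; rewrite -[X in measurable X]setTI; exact: letterwise_measurable. Qed.

Lemma eqlaw_lawmap mu nu : eqlaw mu nu -> eqlaw (lawmap f mu) (lawmap f nu).
Proof.
by move=> h C mC; rewrite !lawmapE h//; exact: letterwise_measurable_preimage.
Qed.

Lemma continuous_letterwise_comp (g : conf B -> R) :
  continuous g -> continuous (g \o letterwise f).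
Proof.
by move=> cg xi; apply: continuous_comp; [exact: letterwise_continuous|exact: cg].
Qed.

Lemma bounded_letterwise_comp (g : conf B -> R) :
  bounded_fun g -> bounded_fun (g \o letterwise f).
Proof. by move=> [M [Mr h]]; exists M; split => // x Mx xi _; exact: h. Qed.

Lemma integral_lawmap nu (g : conf B -> R) : continuous g -> bounded_fun g ->
  (\int[lawmap f nu]_xi (g xi)%:E = \int[nu]_xi (g (letterwise f xi))%:E)%E.
Proof.
move=> cg bg; apply: (@integral_distribution _ _ _ _ _ _ _ (EFin \o g)).
  by apply/measurable_EFinP; exact: continuous_conf_measurable.
apply: (@continuous_conf_integrable _ _ nu (g \o letterwise f)).
  exact: continuous_letterwise_comp.
exact: bounded_letterwise_comp.
Qed.

Lemma weak_cvg_lawmap (nu_ : nat -> probability (conf A) R) nu :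
  weak_cvg nu_ nu -> weak_cvg (fun t => lawmap f (nu_ t)) (lawmap f nu).
Proof.
move=> h g cg bg; rewrite integral_lawmap//.
have := h _ (continuous_letterwise_comp cg) (bounded_letterwise_comp bg).
apply: cvg_trans; apply: near_eq_cvg; apply: nearW => t /=.
by rewrite integral_lawmap.
Qed.

End lawmap.

Lemma lawmap_cancel (R : realType) (A B : alphabetType) (f : A -> B) (g : B -> A) :
  cancel f g -> forall nu : probability (conf A) R,
  eqlaw (lawmap g (lawmap f nu)) nu.
Proof.
move=> fK nu C _; rewrite !lawmapE; congr (nu _).
have E xi : letterwise g (letterwise f xi) = xi.
  by apply/funext => x; exact: fK.
by apply/seteqP; split => xi /=; rewrite E.
Qed.

(** Sites are updated independently, so a one-site identity determines all cylinder probabilities.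
    The maps [g] on the input and [f] on the output are kept distinct because one envelope step
    exchanges the two components. *)
Lemma step_lawmap (R : realType) (A B : alphabetType) (F : pca R A)
    (G : pca R B) (f g : A -> B) :
  (forall xi x b, site_law G (letterwise g xi) x b =
    \sum_(a | f a == b) site_law F xi x a) ->
  forall nu, eqlaw (step G (lawmap g nu)) (lawmap f (step F nu)).
Proof.
move=> h nu C mC; rewrite lawmapE.
transitivity (\int[nu]_xi update_law G (letterwise g xi) C)%E.
  by apply: ge0_integral_distribution => //; exact: measurable_update_law.
apply: eq_integral => xi _.
apply: (@eqlaw_cylinder _ _ _ (lawmap f (update_law F xi))) => // S D uS.
rewrite lawmapE preimage_letterwise_cylinder !update_lawE//; congr EFin.
(* Group the letters [a] by their image under [f]. *)
apply: eq_bigr => x _; rewrite (partition_big f (mem (D x))) => [|a]; last first.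
  by rewrite inE.
apply: eq_bigr => b bD; rewrite h; apply: eq_bigl => a.
by rewrite inE; case: eqP => [->|_]; rewrite ?bD ?andbF.
Qed.

Lemma iter_step_lawmap (R : realType) (A B : alphabetType) (F : pca R A)
    (G : pca R B) (f : A -> B) :
  (forall xi x b, site_law G (letterwise f xi) x b =
    \sum_(a | f a == b) site_law F xi x a) ->
  forall nu t, eqlaw (iter t (step G) (lawmap f nu)) (lawmap f (iter t (step F) nu)).
Proof.
move=> h nu; elim=> [//|t ih] /=.
by apply: eqlaw_trans (step_lawmap h _); exact: eqlaw_step.
Qed.

(* The letters 0, ? and 1 of the envelope encode the pairs (0,0), (0,1) and
   (1,1); low and high are the two components. *)
Definition low (a : option bool) : bool := odflt false a.
Definition high (a : option bool) : bool := odflt true a.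

(** * One-site identities between the two stochastic matrices *)

Section site_laws.
Context {R : realType} {p q : R}.
Hypothesis pqS : region_S p q.

Lemma big_option_bool (P : pred (option bool)) (E : option bool -> R) :
  \sum_(a | P a) E a =
  (if P None then E None else 0) + (if P (Some true) then E (Some true) else 0)
  + (if P (Some false) then E (Some false) else 0).
Proof.
rewrite big_mkcond (bigD1 None)//= (bigD1 (Some true))//= (bigD1 (Some false))//=.
by rewrite big1 ?addr0 ?addrA // => -[[]|].
Qed.

Lemma phi_env_map_some (v : 3.-tuple bool) b :
  phi_env p q (map_tuple Some v) b = \sum_(a | Some a == b) phi p q v a.
Proof.
rewrite big_mkcond big_bool /=.
case: v => -[|a [|a' [|a'' []]]] //= i; rewrite /phi_env /phi -!val_eqE /= !inE.
by case: a a' a'' {i} => [] [] []; case: b => [[]|] /=; rewrite ?addr0 ?add0r.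
Qed.

(** [low] of the new letter is 1 only for the letter 1, which the envelope produces with probability
    [1 - p] at (0,0,0) and [q] elsewhere; and [high] maps only (0,0,0) to the zero triple. *)
Lemma phi_map_high (v : 3.-tuple (option bool)) b :
  phi p q (map_tuple high v) b = \sum_(a | low a == b) phi_env p q v a.
Proof.
rewrite big_option_bool.
case: v => -[|a [|a' [|a'' []]]] //= i; rewrite /phi_env /phi -!val_eqE /= !inE.
by case: a a' a'' {i} => [[]|] [[]|] [[]|]; case: b => /=; rewrite ?addr0 ?add0r //; ring.
Qed.

(** Dually, [high] of the new letter is 0 only for the letter 0, of probability [p] when every input
    letter is 0 or ?, that is when [low] gives the zero triple, and [1 - q] otherwise. *)
Lemma phi_map_low (v : 3.-tuple (option bool)) b :
  phi p q (map_tuple low v) b = \sum_(a | high a == b) phi_env p q v a.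
Proof.
rewrite big_option_bool.
case: v => -[|a [|a' [|a'' []]]] //= i; rewrite /phi_env /phi -!val_eqE /= !inE.
by case: a a' a'' {i} => [[]|] [[]|] [[]|]; case: b => /=; rewrite ?addr0 ?add0r //; ring.
Qed.

Lemma map_tuple_letterwise n (A B : alphabetType) (f : A -> B) (xi : conf A) x
    (s : n.-tuple int) :
  map_tuple (fun y => letterwise f xi (x + y)) s =
  map_tuple f (map_tuple (fun y => xi (x + y)) s).
Proof. by apply: val_inj; rewrite /= -map_comp. Qed.

Lemma site_law_env_some xi x b :
  site_law (envelope_pq pqS) (letterwise Some xi) x b =
  \sum_(a | Some a == b) site_law (pca_pq pqS) xi x a.
Proof. by rewrite /site_law map_tuple_letterwise; exact: phi_env_map_some. Qed.

Lemma site_law_high xi x b :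
  site_law (pca_pq pqS) (letterwise high xi) x b =
  \sum_(a | low a == b) site_law (envelope_pq pqS) xi x a.
Proof. by rewrite /site_law map_tuple_letterwise; exact: phi_map_high. Qed.

Lemma site_law_low xi x b :
  site_law (pca_pq pqS) (letterwise low xi) x b =
  \sum_(a | high a == b) site_law (envelope_pq pqS) xi x a.
Proof. by rewrite /site_law map_tuple_letterwise; exact: phi_map_low. Qed.

End site_laws.

(** * Ergodicity of the PCA and of its envelope *)

Section envelope.
Context {R : realType} {p q : R}.
Variable pqS : region_S p q.
Let F := pca_pq pqS.
Let Fh := envelope_pq pqS.
Implicit Types mu : probability (conf bool) R.
Implicit Types nu : probability (conf (option bool)) R.

Lemma step_some mu : eqlaw (step Fh (lawmap Some mu)) (lawmap Some (step F mu)).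
Proof. exact: step_lawmap (site_law_env_some pqS) mu. Qed.

Lemma step_high nu : eqlaw (step F (lawmap high nu)) (lawmap low (step Fh nu)).
Proof. exact: step_lawmap (site_law_high pqS) nu. Qed.

Lemma step_low nu : eqlaw (step F (lawmap low nu)) (lawmap high (step Fh nu)).
Proof. exact: step_lawmap (site_law_low pqS) nu. Qed.

Lemma ergodic_of_envelope : ergodic Fh -> ergodic F.
Proof.
move=> /ergodicP[muh smuh cmuh]; apply/ergodicP.
(* Without ?, the envelope runs as [F], and any left inverse of [Some] recovers the
   configuration. *)
have cvgs (f : option bool -> bool) mu : cancel Some f ->
    weak_cvg (fun t => iter t (step F) mu) (lawmap f muh).
  move=> fS; apply: weak_cvg_eqlaw (weak_cvg_lawmap (f := f) (cmuh (lawmap Some mu))).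
  move=> t; apply: eqlaw_trans (lawmap_cancel fS _).
  exact/eqlaw_lawmap/(iter_step_lawmap (site_law_env_some pqS)).
have lowK : cancel Some low by [].
have highK : cancel Some high by [].
exists (lawmap low muh) => [|mu]; last exact: cvgs.
(* A step turns the [low] image of [muh] into its [high] image. The two agree, being limits of the
   same iterates; the initial law is arbitrary here. *)
apply: eqlaw_trans (step_low _) _; apply: (eqlaw_trans (eqlaw_lawmap _ smuh)).
exact: weak_cvg_unique (cvgs _ (lawmap low muh) highK) (cvgs _ _ lowK).
Qed.

Section components.
Variable nu : probability (conf (option bool)) R.
Let nu_ t := iter t (step Fh) nu.

(** The components are exchanged at every step, so the order of [f] and [g] follows the parity of
    [t]; the disjunction avoids tracking it. *)
Lemma component_laws t : exists f g : option bool -> bool,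
  [/\ (f, g) = (low, high) \/ (f, g) = (high, low),
      eqlaw (lawmap low (nu_ t)) (iter t (step F) (lawmap f nu)) &
      eqlaw (lawmap high (nu_ t)) (iter t (step F) (lawmap g nu))].
Proof.
elim: t => [|t [f [g [fg hl hh]]]].
  by exists low, high; split => //; left.
exists g, f; split; first by case: fg => -[-> ->]; [right|left].
  by apply: eqlaw_trans (eqlaw_sym (step_high _)) _; exact: eqlaw_step.
by apply: eqlaw_trans (eqlaw_sym (step_low _)) _; exact: eqlaw_step.
Qed.

Variable mu : probability (conf bool) R.
Hypothesis cvg_mu : forall la, weak_cvg (fun t => iter t (step F) la) mu.

(** At each time the component follows one of two orbits of [F]. Both orbits converge to [mu], so
    eventually both lie in the given neighbourhood. *)
Lemma weak_cvg_component (c : option bool -> bool) :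
  c = low \/ c = high -> weak_cvg (fun t => lawmap c (nu_ t)) mu.
Proof.
move=> cE f cf bf U Ul.
have nearU la : \forall t \near \oo,
  U (\int[iter t (step F) la]_xi (f xi)%:E)%E by exact: cvg_mu.
apply: filterS2 (nearU (lawmap low nu)) (nearU (lawmap high nu)) => t Ulow Uhigh.
have [c1 [c2 [c12 /eqlaw_integral h1 /eqlaw_integral h2]]] := component_laws t.
by case: cE => ->; rewrite /preimage/= ?h1 ?h2; case: c12 => -[e1 e2];
  rewrite ?e1 ?e2.
Qed.

Definition unknown (n : nat) : set (conf (option bool)) :=
  [set xi | exists2 x : int, (pickle x < n)%N & xi x = None].

Lemma determined_unknown n : determined n (unknown n).
Proof. by move=> xi zeta h [x xn xN]; exists x; rewrite // -h. Qed.

(** The letter ? is the only one whose components differ, so its probability is that of a 1 in the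
    [high] component minus that of a 1 in the [low] one; these have the same limit. *)
Lemma cvg_unknown_site (x : int) :
  nu_ t [set xi | xi x = None] @[t --> \oo] --> 0%E.
Proof.
pose C : set (conf bool) := [set xi | xi x = true].
have dC : determined (pickle x).+1 C.
  by move=> xi zeta h; rewrite /C /= h.
have mC := determined_measurable dC.
have E t : nu_ t [set xi | xi x = None] =
    (lawmap high (nu_ t) C - lawmap low (nu_ t) C)%E.
  have -> : lawmap high (nu_ t) C =
      (nu_ t [set xi | xi x = None] + lawmap low (nu_ t) C)%E.
    rewrite !lawmapE -measureU.
    - congr (nu_ t _); apply/seteqP; split => xi; rewrite /C/=/letterwise.
        by case: (xi x) => [[]|] //= _; [right|left].
      by case=> [->|] //; case: (xi x) => [[]|].
    - apply: (@determined_measurable _ (pickle x).+1) => xi zeta h /=.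
      by rewrite h.
    - exact: letterwise_measurable_preimage.
    - apply/seteqP; split => // xi [/=]; rewrite /letterwise /C /= => -> //.
  by rewrite addeK// fin_num_measure//; exact: letterwise_measurable_preimage.
rewrite (_ : (fun t => _) =
  (fun t => lawmap high (nu_ t) C - lawmap low (nu_ t) C)%E); last exact/funext.
rewrite -(@subee _ (mu C)) ?fin_num_measure//.
apply: cvgeB; first by rewrite fin_num_adde_defl// fin_numN fin_num_measure.
  by apply: weak_cvg_determined dC; apply: weak_cvg_component; right.
by apply: weak_cvg_determined dC; apply: weak_cvg_component; left.
Qed.

Lemma cvg_unknown n : nu_ t (unknown n) @[t --> \oo] --> 0%E.
Proof.
have mS (x : int) : measurable [set xi : conf (option bool) | xi x = None].
  by apply: (@determined_measurable _ (pickle x).+1) => xi zeta h /=; rewrite h.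
have mU m : measurable (unknown m) by exact: determined_measurable (@determined_unknown m).
elim: n => [|n ih].
  have -> : unknown 0 = set0 by apply/seteqP; split => // xi [].
  rewrite (_ : (fun t => _) = fun=> 0%E); first exact: cvg_cst.
  by apply/funext => t; rewrite measure0.
have [[x xn]|nx] := pselect (exists x : int, pickle x = n); last first.
  suff -> : unknown n.+1 = unknown n by [].
  apply/seteqP; split => xi [x xn xN]; exists x => //; last exact: ltnW.
  move: xn; rewrite ltnS leq_eqVlt => /orP[/eqP xn|//].
  by case: nx; exists x.
(* Union bound: a ? among the first [n.+1] sites is either among the first [n] or at [x]. *)
apply: (@squeeze_cvge _ _ _ R (fun=> 0%E) _
   (fun t => nu_ t (unknown n) + nu_ t [set xi | xi x = None])%E).
- apply: nearW => t; rewrite measure_ge0/=.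
  apply: (@le_trans _ _ (nu_ t (unknown n `|` [set xi | xi x = None]))); last first.
    exact: measureU2.
  apply: le_measure; rewrite ?inE//; first exact: measurableU.
  move=> xi [y yn yN]; move: yn; rewrite ltnS leq_eqVlt => /orP[/eqP yn|yn].
    by right; rewrite /= (_ : x = y)//; apply: (pcan_inj (@pickleK int)); rewrite xn.
  by left; exists y.
- exact: cvg_cst.
- rewrite -[X in _ --> X](@adde0 R); apply: cvgeD => //; exact: cvg_unknown_site.
Qed.

(** Replacing every ? by 0 turns [f] into [h], a function of the [low] component, whose integrals
    converge. By uniform continuity [f] and [h] are close unless a ? occurs among finitely many
    sites, an event of vanishing probability. *)
Lemma weak_cvg_envelope : weak_cvg nu_ (lawmap Some mu).
Proof.
move=> f cf bf; rewrite integral_lawmap//.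
pose g : conf bool -> R := f \o letterwise Some.
have cg : continuous g by exact: continuous_letterwise_comp.
have bg : bounded_fun g by exact: bounded_letterwise_comp.
pose h : conf (option bool) -> R := g \o letterwise low.
have ch : continuous h by exact: continuous_letterwise_comp.
have bh : bounded_fun h by exact: bounded_letterwise_comp.
have If t := continuous_conf_integrable (nu_ t) cf bf.
have Ih t := continuous_conf_integrable (nu_ t) ch bh.
pose D t := (\int[nu_ t]_xi (f xi - h xi)%:E)%E.
have ID t : (nu_ t).-integrable setT (EFin \o (f \- h)).
  rewrite (_ : EFin \o _ = (EFin \o f) \- (EFin \o h))%E//.
  by apply: integrableB => //; [exact: If|exact: Ih].
have finD t : D t \is a fin_num by apply: integrable_fin_num (ID t).
have D0 : D t @[t --> \oo] --> 0%E.
  apply/fine_cvgP; split.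
    by apply: nearW => t; exact: finD.
  have [M M0 fM] : exists2 M, 0 < M & forall xi, `|f xi| <= M.
    (* [bounded_fun] only provides bounds strictly above its witness; adding 1 also makes the bound
       positive. *)
    have [M [_ hM]] := bf; exists (`|M| + 1); first by rewrite ltr_wpDl.
    by move=> xi; apply: hM => //; rewrite (le_lt_trans (ler_norm M))// ltrDl.
  apply/cvgr0Pnorm_lt => e e0.
  have e2 : 0 < e / 2 by rewrite divr_gt0.
  have [n fn] := uniformly_continuous cf e2.
  have mU := determined_measurable (@determined_unknown n).
  have fhU xi : `|f xi - h xi| <= e / 2 + 2 * M * \1_(unknown n) xi.
    rewrite indicE; case: (boolP (xi \in _)) => [_|/negP]; last rewrite inE => xiU.
      rewrite mulr1 (le_trans (ler_normB _ _))//.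
      by have := fM xi; have := fM (letterwise Some (letterwise low xi)); rewrite /h /g /=; lra.
    rewrite mulr0 addr0 ltW// fn// => x xn.
    by rewrite /letterwise; case E: (xi x) => [//|]; case: xiU; exists x.
  have /fine_cvgP[_ /cvgr0Pnorm_lt U0] := cvg_unknown n.
  (* Below this probability of [unknown n], the bad event contributes less than [e / 2], since there
     [f] and [h] differ by at most [2 * M]. *)
  have eM : 0 < e / 2 / (2 * M) by rewrite divr_gt0// mulr_gt0.
  have := U0 _ eM; apply: filterS => t /= Ut.
  rewrite -lte_fin -fine_abse// fineK ?abse_fin_num//.
  apply: (@le_lt_trans _ _ ((e / 2)%:E + (2 * M)%:E * nu_ t (unknown n))%E).
    have mfh := measurable_int _ (ID t).
    apply: (le_trans (le_abse_integral _ _ mfh)) => //.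
    apply: (@le_trans _ _ (\int[nu_ t]_xi ((e / 2)%:E + (2 * M)%:E * (\1_(unknown n) xi)%:E))%E).
      apply: ge0_le_integral => //.
      - exact: measurableT_comp.
      - apply/measurable_EFinP; apply: measurable_funD => //.
        by apply: measurable_funM => //; exact: measurable_indic.
      - by move=> xi _; rewrite /= lee_fin.
    have M20 : 0 <= 2 * M by rewrite mulr_ge0 ?ltW.
    rewrite ge0_integralD//; first last.
    - apply/measurable_EFinP; apply: measurable_funM => //; exact: measurable_indic.
    - by move=> xi _; rewrite lee_fin mulr_ge0// indicE.
    - by move=> xi _; rewrite lee_fin ltW.
    rewrite integral_cst// [X in (_ * X)%E](_ : _ = 1%E); last first.
      exact: probability_setT.
    rewrite mule1 ge0_integralZl_EFin//.
      by rewrite integral_indic// setIT.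
    by apply/measurable_EFinP; exact: measurable_indic.
  rewrite -(@fineK _ (nu_ t (unknown n))) ?fin_num_measure// -EFinM -EFinD lte_fin.
  rewrite [ltRHS]splitr ltrD2l -ltr_pdivlMl ?mulr_gt0// mulrC.
  exact: le_lt_trans (ler_norm _) Ut.
(* Split [f] as [h] plus the error [f - h], and read the integral of [h] as one over the [low]
   component. *)
rewrite (_ : (fun t => _) = (fun t => \int[lawmap low (nu_ t)]_xi (g xi)%:E + D t)%E); last first.
  apply/funext => t; rewrite integral_lawmap// /D.
  under [X in (_ + X)%E]eq_integral do rewrite EFinB.
  rewrite integralB_EFin//; [|exact: If|exact: Ih].
  by rewrite addeC subeK//; exact: integrable_fin_num (Ih t).
rewrite -[X in _ --> X]adde0; apply: cvgeD => //.
  by rewrite fin_num_adde_defl.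
by apply: weak_cvg_component => //; left.
Qed.

End components.

(** The limit law is carried by configurations without ?, where the envelope acts as [F], hence its
    stationarity. *)
Lemma envelope_ergodic : ergodic F -> ergodic Fh.
Proof.
move=> /ergodicP[mu smu cmu]; apply/ergodicP; exists (lawmap Some mu).
  apply: eqlaw_trans (step_some mu) _; exact: eqlaw_lawmap.
by move=> nu; exact: weak_cvg_envelope.
Qed.

End envelope.

Theorem proposition2p3 (R : realType) (p q : R) (pqS : region_S p q) :
  ergodic (pca_pq pqS) <-> ergodic (envelope_pq pqS).
Proof. by split; [exact: envelope_ergodic|exact: ergodic_of_envelope]. Qed.
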